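(* Let $\nu$ be a volume form on the homogeneous space $G/H$, and let $\sigma:G\to\mathbb{R}$ be the function associated with $\nu$, i.e. the smooth function with $\sigma(e)=0$ and $q^*\nu=e^{\sigma}\,\overleftarrow{\mathcal{V}_0}$, where $\mathcal{V}_0=(q^*\nu)(e)\in\wedge^{m-n}\mathfrak{h}^0$. Then $\nu$ is semi-invariant if and only if $\sigma$ is multiplicative.
   Context: $G$ is a connected Lie group of dimension $m$ with Lie algebra $\mathfrak{g}$ and identity $e$; $H\subset G$ is a closed connected Lie subgroup of dimension $n$ with Lie algebra $\mathfrak{h}$; $q:G\to G/H$ is the projection; $\mathfrak{h}^0\subset\mathfrak{g}^*$ is the annihilator of $\mathfrak{h}$. $\overleftarrow{\mathcal{V}_0}$ is the left-invariant form on $G$ whose value at $e$ is $\mathcal{V}_0$. For every volume form $\nu$ on $G/H$ a smooth function $\sigma$ as in the claim exists and is unique. $\phi:G\times G/H\to G/H$, $\phi_g(g'H)=gg'H$, is the transitive action. A volume form $\nu$ on $G/H$ is semi-invariant if there is a smooth function $c:G\to\mathbb{R}^+$ with $\phi_g^*\nu=c(g)\nu$ for all $g\in G$. A function $\sigma:G\to\mathbb{R}$ is multiplicative if $\sigma(gh)=\sigma(g)+\sigma(h)$ for all $g,h\in G$. *)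

(* Defs.v *)
From HB Require Import structures.
From mathcomp Require Import all_boot all_order all_algebra.
From mathcomp Require Import generic_quotient.
From mathcomp Require Import all_classical all_reals all_analysis.

Set Implicit Arguments.
Unset Strict Implicit.
Unset Printing Implicit Defensive.

Import Order.TTheory GRing.Theory Num.Theory.
Import numFieldNormedType.Exports.

Local Open Scope classical_set_scope.
Local Open Scope ring_scope.

(* C^k and C^oo maps on an open set U.  The recursion through directional
   differentials is the usual notion when V is finite dimensional, the only
   case used below (V is 'rV_d or a product of two such spaces). *)
Fixpoint Ck (R : realType) (V W : normedModType R) (k : nat)
    (U : set V) (f : V -> W) : Prop :=
  if k is k'.+1 then
    (forall x, U x -> differentiable f x) /\
    (forall v : V, Ck k' U (fun x => 'd f x v))
  else forall x, U x -> {for x, continuous f}.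

Definition Cinfty (R : realType) (V W : normedModType R)
    (U : set V) (f : V -> W) : Prop := forall k, Ck k U f.

(* [chart_map] and [chart_inv] are total functions; they are only meaningful
   on [chart_dom] and [chart_cod] respectively. *)
Record chart (R : realType) (d : nat) (M : topologicalType) := Chart {
  chart_dom : set M;
  chart_cod : set 'rV[R]_d;
  chart_map :> M -> 'rV[R]_d;
  chart_inv : 'rV[R]_d -> M;
  chart_dom_open : open chart_dom;
  chart_cod_open : open chart_cod;
  chart_mapP : forall x, chart_dom x -> chart_cod (chart_map x);
  chart_invP : forall y, chart_cod y -> chart_dom (chart_inv y);
  chart_mapK : forall x, chart_dom x -> chart_inv (chart_map x) = x;
  chart_invK : forall y, chart_cod y -> chart_map (chart_inv y) = y;
  chart_map_continuous :
    forall x, chart_dom x -> {for x, continuous chart_map};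
  chart_inv_continuous :
    forall y, chart_cod y -> {for y, continuous chart_inv} }.

Definition compatible (R : realType) (d : nat) (M : topologicalType)
    (a b : chart R d M) : Prop :=
  Cinfty [set y | chart_cod a y /\ chart_dom b (chart_inv a y)]
         (b \o chart_inv a) /\
  Cinfty [set y | chart_cod b y /\ chart_dom a (chart_inv b y)]
         (a \o chart_inv b).

Record smooth_structure (R : realType) (d : nat) (M : topologicalType) :=
  SmoothStructure {
    atlas : set (chart R d M);
    atlas_cover : forall p : M, exists2 a, atlas a & chart_dom a p;
    atlas_compatible : forall a b, atlas a -> atlas b -> compatible a b;
    smooth_hausdorff : hausdorff_space M;
    smooth_second_countable : @second_countable M }.

(* The tangent space at p is represented by 'rV_d, through the coordinates of
   the chart [chart_at S p] of the atlas chosen once and for all around p. *)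
Definition chart_at (R : realType) (d : nat) (M : topologicalType)
    (S : smooth_structure R d M) (p : M) : chart R d M :=
  s2val (cid2 (atlas_cover S p)).

Section Manifolds.
Context {R : realType}.

Definition smooth_on (d e : nat) (M N : topologicalType)
    (S : smooth_structure R d M) (T : smooth_structure R e N)
    (U : set M) (f : M -> N) : Prop :=
  [/\ open U, forall x, U x -> {for x, continuous f} &
    forall a b, atlas S a -> atlas T b ->
      Cinfty [set y | [/\ chart_cod a y, U (chart_inv a y)
                        & chart_dom b (f (chart_inv a y))]]
             (b \o f \o chart_inv a)].

Definition smooth (d e : nat) (M N : topologicalType)
    (S : smooth_structure R d M) (T : smooth_structure R e N)
    (f : M -> N) : Prop := smooth_on S T [set: M] f.

(* Smoothness on the product manifold M1 x M2, read in product charts. *)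
Definition smooth2 (d1 d2 e : nat) (M1 M2 N : topologicalType)
    (S1 : smooth_structure R d1 M1) (S2 : smooth_structure R d2 M2)
    (T : smooth_structure R e N) (f : M1 -> M2 -> N) : Prop :=
  continuous (fun z : M1 * M2 => f z.1 z.2) /\
  forall a1 a2 b, atlas S1 a1 -> atlas S2 a2 -> atlas T b ->
    Cinfty [set z : 'rV[R]_d1 * 'rV[R]_d2 |
              [/\ chart_cod a1 z.1, chart_cod a2 z.2
                & chart_dom b (f (chart_inv a1 z.1) (chart_inv a2 z.2))]]
           (fun z => b (f (chart_inv a1 z.1) (chart_inv a2 z.2))).

Definition smooth_fun (d : nat) (M : topologicalType)
    (S : smooth_structure R d M) (f : M -> R) : Prop :=
  forall a, atlas S a ->
    Cinfty (chart_cod a) (f \o chart_inv a : 'rV[R]_d -> R^o).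

Definition tangent_map (d e : nat) (M N : topologicalType)
    (S : smooth_structure R d M) (T : smooth_structure R e N)
    (f : M -> N) (p : M) : 'rV[R]_d -> 'rV[R]_e :=
  'd (chart_at T (f p) \o f \o chart_inv (chart_at S p)) (chart_at S p p).

Definition multilinear (d k : nat) (w : ('I_k -> 'rV[R]_d) -> R) : Prop :=
  forall (v : 'I_k -> 'rV[R]_d) (i : 'I_k) (c : R) (x y : 'rV[R]_d),
    let upd z := fun j => if j == i then z else v j in
    w (upd (c *: x + y)) = c * w (upd x) + w (upd y).

Definition alternating (d k : nat) (w : ('I_k -> 'rV[R]_d) -> R) : Prop :=
  forall (v : 'I_k -> 'rV[R]_d) (i j : 'I_k),
    i != j -> v i = v j -> w v = 0.

Definition preform (d k : nat) (M : topologicalType) :=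
  M -> ('I_k -> 'rV[R]_d) -> R.

(* The smoothness clause says that, in every chart a of the atlas, the
   coefficients of w in the coordinates of a are smooth: the differential of
   [chart_at S p \o chart_inv a] turns constant vectors in the coordinates of a
   into tangent vectors at p. *)
Definition is_form (d k : nat) (M : topologicalType)
    (S : smooth_structure R d M) (w : preform d k M) : Prop :=
  [/\ forall p, multilinear (w p), forall p, alternating (w p) &
    forall a, atlas S a -> forall v : 'I_k -> 'rV[R]_d,
      Cinfty (chart_cod a)
        (fun y => w (chart_inv a y)
           (fun i => 'd (chart_at S (chart_inv a y) \o chart_inv a) y (v i))
         : R^o)].

Definition is_volume_form (d : nat) (M : topologicalType)
    (S : smooth_structure R d M) (w : preform d d M) : Prop :=
  is_form S w /\ forall p, exists v, w p v != 0.

Definition pullback (d e k : nat) (M N : topologicalType)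
    (S : smooth_structure R d M) (T : smooth_structure R e N)
    (f : M -> N) (w : preform e k N) : preform d k M :=
  fun p v => w (f p) (fun i => tangent_map S T f p (v i)).

(* A is, near each of its points, a coordinate n-plane in some chart of the
   maximal atlas. *)
Definition embedded_submanifold (d : nat) (M : topologicalType)
    (S : smooth_structure R d M) (n : nat) (A : set M) : Prop :=
  (n <= d)%N /\
  forall p, A p -> exists c : chart R d M,
    [/\ forall a, atlas S a -> compatible c a, chart_dom c p &
      forall x, chart_dom c x ->
        (A x <-> forall i : 'I_d, (n <= i)%N -> c x 0 i = 0)].

End Manifolds.

HB.mixin Record isLieGroup (R : realType) (m : nat) G
    of Group G & Topological G := {
  lie_structure : smooth_structure R m G;
  lie_mul_smooth :
    smooth2 lie_structure lie_structure lie_structure (fun x y : G => (x * y)%g);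
  lie_inv_smooth :
    smooth lie_structure lie_structure (fun x : G => (x^-1)%g) }.

#[short(type="lieGroupType")]
HB.structure Definition LieGroup (R : realType) (m : nat) :=
  {G of Group G & Topological G & isLieGroup R m G}.

Section HomogeneousSpace.
Context {R : realType} {m : nat} {G : lieGroupType R m}.
Variable H : groupClosed G.

Definition closed_connected_lie_subgroup (n : nat) : Prop :=
  [/\ closed [set` H], connected [set` H] &
      embedded_submanifold (lie_structure : smooth_structure R m G) n [set` H]].

Definition coset_rel : rel G := fun x y => (x^-1 * y)%g \in H.

Lemma coset_rel_refl : reflexive coset_rel.
Proof. by move=> x; rewrite /coset_rel mulVg gpred1. Qed.

Lemma coset_rel_sym : symmetric coset_rel.
Proof. by move=> x y; rewrite /coset_rel -gpredV invgM invgK. Qed.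

Lemma coset_rel_trans : transitive coset_rel.
Proof.
move=> y x z; rewrite /coset_rel => xy yz.
by have := gpredM _ _ xy yz; rewrite -mulgA mulVKg.
Qed.

Canonical coset_equiv :=
  EquivRel coset_rel coset_rel_refl coset_rel_sym coset_rel_trans.

Local Notation Q := (quotient_topology {eq_quot coset_equiv}%qT).

Definition homogeneous_space : topologicalType := Q.

Definition coset_proj (g : G) : homogeneous_space := (\pi_Q g)%qT.

Lemma coset_projP (x y : G) :
  coset_proj x = coset_proj y <-> (x^-1 * y)%g \in H.
Proof.
by split=> [/eqmodP|?] //; apply/eqmodP.
Qed.

Definition coset_action (g : G) (x : homogeneous_space) : homogeneous_space :=
  coset_proj (g * repr (x : Q))%g.

Lemma coset_actionE (g g' : G) :
  coset_action g (coset_proj g') = coset_proj (g * g')%g.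
Proof.
apply/coset_projP; rewrite invgM -mulgA mulKg; apply/coset_projP.
exact: reprK.
Qed.

(* The (unique) smooth structure of the homogeneous space: the projection is
   smooth and has smooth local sections. *)
Definition homogeneous_structure (d : nat)
    (S : smooth_structure R d homogeneous_space) : Prop :=
  smooth lie_structure S coset_proj /\
  forall x : homogeneous_space, exists U : set homogeneous_space,
    U x /\ exists2 s : homogeneous_space -> G,
      smooth_on S lie_structure U s & forall y, U y -> coset_proj (s y) = y.

Definition left_invariant_form (k : nat) (w : ('I_k -> 'rV[R]_m) -> R)
    : preform m k G :=
  fun g v => w (fun i =>
    tangent_map (lie_structure : smooth_structure R m G) lie_structure
      (fun x => (g^-1 * x)%g) g (v i)).

Definition semi_invariant (d : nat)
    (S : smooth_structure R d homogeneous_space)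
    (nu : preform d d homogeneous_space) : Prop :=
  exists c : G -> R,
    [/\ smooth_fun lie_structure c, forall g, 0 < c g &
      forall g x v, pullback S S (coset_action g) nu x v = c g * nu x v].

Definition associated_function (d : nat)
    (S : smooth_structure R d homogeneous_space)
    (nu : preform d d homogeneous_space) (sigma : G -> R) : Prop :=
  let qnu : preform m d G := pullback lie_structure S coset_proj nu in
  [/\ smooth_fun lie_structure sigma, sigma 1%g = 0 &
    forall g v,
      qnu g v = expR (sigma g) * left_invariant_form (qnu 1%g) g v].

Definition multiplicative_function (sigma : G -> R) : Prop :=
  forall g h : G, sigma (g * h)%g = sigma g + sigma h.

End HomogeneousSpace.

(* Main.v *)
Require Import Defs.
From mathcomp Require Import all_boot all_order all_algebra.
From mathcomp Require Import all_classical all_reals all_analysis.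

(* Write L_g for left translation and phi_g for the action, so that
   phi_g \o q = q \o L_g.  The equation q^* nu = e^sigma w with w left-invariant
   gives
     L_g^* (q^* nu) = e^(sigma (g x) - sigma x) q^* nu   at x,
   while the left-hand side is also q^* (phi_g^* nu).  Since q is a submersion
   (it has smooth local sections) and nu vanishes nowhere, phi_g^* nu = c(g) nu
   holds exactly when sigma (g x) - sigma x = ln c(g) for all x; at x = e this
   forces ln c = sigma. *)

Set Implicit Arguments.
Unset Strict Implicit.
Unset Printing Implicit Defensive.

Import Order.TTheory GRing.Theory Num.Theory.
Import numFieldNormedType.Exports.

Local Open Scope classical_set_scope.
Local Open Scope ring_scope.

(** * Differential calculus: locality, sums, products and exponentials *)

Section Calculus.
Context {R : realType} {V : normedModType R}.

(** Since [g - f] vanishes near [x], it is a little-o and has zero differential there; then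
    [g = f + (g - f)] inherits the differential of [f]. *)
Lemma near_is_diff {W : normedModType R} (f g df : V -> W) (x : V) :
  (\forall y \near x, f y = g y) -> is_diff x f df -> is_diff x g df.
Proof.
move=> fg dfx.
have fgx := nbhs_singleton fg.
have gf0 : (g - f) \o shift x = cst ((g - f) x) + (0 : V -> W) +o_ 0 id.
  apply/eqaddoP => _/posnumP[e].
  have := fg; rewrite (near_shift 0 x) subr0.
  apply: filterS => y /= fgy.
  rewrite !fctE /= fgy fgx !subrr addr0 subr0 normr0.
  by rewrite mulr_ge0.
have d0 : 'd (g - f) x = (0 : V -> W) :> (V -> W).
  apply: (@diff_unique _ _ _ _ (\0 : {linear V -> W})) => //.
  exact: cst_continuous.
have -> : g = f + (g - f) by rewrite addrCA subrr addr0.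
have -> : df = df + 0 by rewrite addr0.
apply: is_diffD; apply: DiffDef => //.
by apply/diff_locallyP; rewrite d0; split => //; exact: cst_continuous.
Qed.

(** Openness turns agreement on [U] into agreement near each of its points, so the differentials
    agree on [U] too and the induction goes on. This lets a formula valid only on [U] stand in for a
    differential. *)
Lemma eq_Ck {W : normedModType R} (k : nat) (U : set V) (f g : V -> W) :
  open U -> (forall x, U x -> f x = g x) -> Ck k U f -> Ck k U g.
Proof.
move=> oU; elim: k f g => [|k IH] f g fg /=.
  move=> fC x Ux; apply: cvg_trans (_ : f @ x --> g x).
    apply: near_eq_cvg; apply: filterS (open_nbhs_nbhs (conj oU Ux)) => y Uy.
    exact: fg.
  by rewrite -fg //; exact: fC.
move=> [df dfC].
have dg x : U x -> is_diff x g ('d f x).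
  move=> Ux; apply: (@near_is_diff _ f); last exact/differentiableP/df.
  apply: filterS (open_nbhs_nbhs (conj oU Ux)) => y Uy; exact: fg.
split=> [x Ux|v]; first by case: (dg x Ux).
apply: (IH (fun x => 'd f x v)) (dfC v) => x Ux.
by case: (dg x Ux) => _ ->.
Qed.

Lemma CkW {W : normedModType R} (k : nat) (U : set V) (f : V -> W) :
  Ck k.+1 U f -> Ck k U f.
Proof.
elim: k f => [|k IH] f [df dfC].
  by move=> x Ux; exact/differentiable_continuous/df.
by split=> // v; exact/IH/dfC.
Qed.

Lemma CkD {W : normedModType R} (k : nat) (U : set V) (f g : V -> W) :
  open U -> Ck k U f -> Ck k U g -> Ck k U (f + g).
Proof.
move=> oU; elim: k f g => [|k IH] f g /=.
  by move=> fC gC x Ux; apply: cvgD; [exact: fC|exact: gC].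
move=> [df fC] [dg gC]; split=> [x Ux|v].
  by apply: differentiableD; [exact: df|exact: dg].
apply: eq_Ck (IH _ _ (fC v) (gC v)) => // x Ux.
by rewrite diffD //; [exact: df|exact: dg].
Qed.

Lemma CkM (k : nat) (U : set V) (f g : V -> R^o) :
  open U -> Ck k U f -> Ck k U g -> Ck k U (f * g : V -> R^o).
Proof.
move=> oU; elim: k f g => [|k IH] f g.
  by move=> fC gC x Ux; apply: cvgM; [exact: fC|exact: gC].
move=> fk gk; have [[df fC] [dg gC]] := (fk, gk); split=> [x Ux|v].
  by apply: differentiableM; [exact: df|exact: dg].
(* The product rule leaves one factor undifferentiated; its order is lowered to that of the other
   factor so that the induction hypothesis applies. *)
have [fk' gk'] := (CkW fk, CkW gk).
apply: eq_Ck (CkD oU (IH _ _ fk' (gC v)) (IH _ _ gk' (fC v))) => // x Ux.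
by rewrite diffM //; [exact: df|exact: dg].
Qed.

Lemma is_diff_expR_comp (f : V -> R^o) (x : V) : differentiable f x ->
  is_diff x (expR \o f : V -> R^o) (fun v => expR (f x) * 'd f x v).
Proof.
move=> df.
have de : differentiable (expR : R^o -> R^o) (f x).
  exact/derivable1_diffP/derivable_expR.
apply: DiffDef; first exact: differentiable_comp.
rewrite diff_comp // diff1E //; apply/funext => v /=.
by rewrite derive1E derive_val mulrC.
Qed.

Lemma Ck_expR (k : nat) (U : set V) (f : V -> R^o) :
  open U -> Ck k U f -> Ck k U (expR \o f : V -> R^o).
Proof.
move=> oU; elim: k f => [|k IH] f.
  by move=> fC x Ux; apply: continuous_comp; [exact: fC|exact: continuous_expR].
move=> fk; have [df fC] := fk; split=> [x Ux|v].
  by case: (is_diff_expR_comp (df x Ux)).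
apply: eq_Ck (CkM oU (IH _ (CkW fk)) (fC v)) => // x Ux.
by case: (is_diff_expR_comp (df x Ux)) => _ ->.
Qed.

End Calculus.

(** * Tangent maps between manifolds and the chain rule *)

Section TangentMaps.
Context {R : realType}.

Lemma chart_at_atlas {d : nat} {M : topologicalType}
  (S : smooth_structure R d M) (p : M) : atlas S (chart_at S p).
Proof. exact: (s2valP (cid2 (atlas_cover S p))). Qed.

Lemma chart_at_dom {d : nat} {M : topologicalType}
  (S : smooth_structure R d M) (p : M) : chart_dom (chart_at S p) p.
Proof. exact: (s2valP' (cid2 (atlas_cover S p))). Qed.

Lemma chart_atK {d : nat} {M : topologicalType}
  (S : smooth_structure R d M) (p : M) :
  chart_inv (chart_at S p) (chart_at S p p) = p.
Proof. exact/chart_mapK/chart_at_dom. Qed.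

Lemma near_chart_inv {d : nat} {M : topologicalType}
  (S : smooth_structure R d M) (p : M) (P : M -> Prop) :
  (\forall x \near p, P x) ->
  \forall y \near chart_at S p p, P (chart_inv (chart_at S p) y).
Proof.
move=> nP.
have := @chart_inv_continuous _ _ _ (chart_at S p) (chart_at S p p)
  (chart_mapP (chart_at_dom S p)).
by rewrite /prop_for /continuous_at chart_atK => /(_ _ nP).
Qed.

Lemma near_chart_cod {d : nat} {M : topologicalType}
  (S : smooth_structure R d M) (p : M) :
  \forall y \near chart_at S p p, chart_cod (chart_at S p) y.
Proof.
apply: open_nbhs_nbhs; split; first exact: chart_cod_open.
exact/chart_mapP/chart_at_dom.
Qed.

Lemma near_chart_dom {d : nat} {M : topologicalType}
  (S : smooth_structure R d M) (p : M) :
  \forall x \near p, chart_dom (chart_at S p) x.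
Proof.
apply: open_nbhs_nbhs; split; first exact: chart_dom_open.
exact: chart_at_dom.
Qed.

(** Continuity is asked for separately: charts are total functions with arbitrary values off their
    domains, so the coordinate expression alone does not control [f] near [p]. *)
Definition mdifferentiable {d e : nat} {M N : topologicalType}
    (S : smooth_structure R d M) (T : smooth_structure R e N)
    (f : M -> N) (p : M) : Prop :=
  {for p, continuous f} /\
  differentiable (chart_at T (f p) \o f \o chart_inv (chart_at S p))
    (chart_at S p p).

Lemma smooth_on_mdifferentiable {d e : nat} {M N : topologicalType}
    (S : smooth_structure R d M) (T : smooth_structure R e N)
    (U : set M) (f : M -> N) (p : M) :
  smooth_on S T U f -> U p -> mdifferentiable S T f p.
Proof.
move=> [_ fC fS] Up; split; first exact: fC.
(* Order 1 of smoothness, read in the two charts that [tangent_map] uses, is the required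
   differentiability. *)
have [+ _] := fS _ _ (chart_at_atlas S p) (chart_at_atlas T (f p)) 1%N.
apply; rewrite /= chart_atK; split=> //; last exact: chart_at_dom.
exact/chart_mapP/chart_at_dom.
Qed.

Lemma near_mdifferentiable {d e : nat} {M N : topologicalType}
    (S : smooth_structure R d M) (T : smooth_structure R e N)
    (f g : M -> N) (p : M) :
  (\forall x \near p, f x = g x) -> mdifferentiable S T f p ->
  mdifferentiable S T g p /\ tangent_map S T g p = tangent_map S T f p.
Proof.
move=> fg [fC df]; have fgp := nbhs_singleton fg.
have gd : is_diff (chart_at S p p)
    (chart_at T (g p) \o g \o chart_inv (chart_at S p)) (tangent_map S T f p).
  rewrite -fgp; apply: (near_is_diff _ (differentiableP df)).
  by apply: filterS (near_chart_inv S fg) => y /= ->.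
split; last by case: gd.
split; last by case: gd.
apply: cvg_trans (_ : f @ p --> g p); first exact: near_eq_cvg.
by rewrite -fgp.
Qed.

Lemma tangent_map_comp {d e k : nat} {M N P : topologicalType}
    (S : smooth_structure R d M) (T : smooth_structure R e N)
    (U : smooth_structure R k P) (f : M -> N) (g : N -> P) (p : M) :
  mdifferentiable S T f p -> mdifferentiable T U g (f p) ->
  mdifferentiable S U (g \o f) p /\
  tangent_map S U (g \o f) p = tangent_map T U g (f p) \o tangent_map S T f p.
Proof.
move=> [fC df] [gC dg].
have gfd : is_diff (chart_at S p p)
    (chart_at U ((g \o f) p) \o (g \o f) \o chart_inv (chart_at S p))
    (tangent_map T U g (f p) \o tangent_map S T f p).
  pose F := chart_at T (f p) \o f \o chart_inv (chart_at S p).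
  have Fp : F (chart_at S p p) = chart_at T (f p) (f p).
    by rewrite /F /= chart_atK.
  (* The middle chart cancels only where [f] lands in its domain; continuity of [f] ensures this
     near [p]. *)
  apply: (@near_is_diff _ _ _
    ((chart_at U (g (f p)) \o g \o chart_inv (chart_at T (f p))) \o F)).
    apply: filterS (near_chart_inv S (fC _ (near_chart_dom T (f p)))).
    by move=> y /= fy; rewrite /F /= chart_mapK.
  apply: is_diff_comp; first exact: differentiableP.
  by rewrite Fp; exact: differentiableP.
split; last by case: gfd.
by split; [exact: continuous_comp|case: gfd].
Qed.

Lemma tangent_map_id {d : nat} {M : topologicalType}
    (S : smooth_structure R d M) (p : M) : tangent_map S S id p = id.
Proof.
suff [_ <-] : is_diff (chart_at S p p)
    (chart_at S p \o id \o chart_inv (chart_at S p)) id by [].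
apply: (@near_is_diff _ _ _ id).
by apply: filterS (near_chart_cod S p) => y /= Sy; rewrite chart_invK.
Qed.

End TangentMaps.

(** * Left translations and left-invariant forms *)

Section LeftTranslations.
Context {R : realType} {m : nat} {G : lieGroupType R m}.

Local Notation lie := (lie_structure : smooth_structure R m G).
Local Notation dL g := (tangent_map lie lie (fun y : G => (g * y)%g)).

(** Left translation is the jointly smooth multiplication restricted to the slice with first factor
    [g], so its chart expression is that of multiplication after an affine inclusion. *)
Lemma mulg_mdifferentiable (g x : G) :
  mdifferentiable lie lie (fun y : G => (g * y)%g) x.
Proof.
have [mC mS] : smooth2 lie lie lie (fun x y : G => (x * y)%g) := lie_mul_smooth.
split.
  have gC : {for x, continuous (fun y : G => (g, y))}.
    exact: cvg_pair (cvg_cst _) cvg_id.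
  exact: (continuous_comp gC (mC (g, x))).
have [+ _] := mS _ _ _ (chart_at_atlas lie g) (chart_at_atlas lie x)
  (chart_at_atlas lie (g * x)%g) 1%N.
move=> /(_ (chart_at lie g g, chart_at lie x x)) /=.
rewrite !chart_atK => md.
pose mul_chart (z : 'rV[R]_m * 'rV[R]_m) := chart_at lie (g * x)%g
  (chart_inv (chart_at lie g) z.1 * chart_inv (chart_at lie x) z.2)%g.
have {}md : differentiable mul_chart (chart_at lie g g, chart_at lie x x).
  by apply: md; split; [exact/chart_mapP/chart_at_dom..|exact: chart_at_dom].
have pd : differentiable (fun y : 'rV[R]_m => (chart_at lie g g, y))
    (chart_at lie x x).
  by apply: differentiable_pair => //; exact: differentiable_cst.
suff <- : mul_chart \o (fun y => (chart_at lie g g, y)) =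
    chart_at lie (g * x)%g \o (fun y : G => (g * y)%g)
      \o chart_inv (chart_at lie x) by exact: differentiable_comp pd md.
by apply/funext => y; rewrite /mul_chart /= chart_atK.
Qed.

Lemma tangent_mulg (g h x : G) : dL g (h * x)%g \o dL h x = dL (g * h)%g x.
Proof.
have [_ <-] := tangent_map_comp
  (mulg_mdifferentiable h x) (mulg_mdifferentiable g (h * x)%g).
by congr (tangent_map _ _ _ _); apply/funext => y /=; rewrite mulgA.
Qed.

(** By the chain rule, translating by [g] and then by the inverse of [g * x] is translating by the
    inverse of [x]. *)
Lemma left_invariant_formM (k : nat) (w : ('I_k -> 'rV[R]_m) -> R) (g x : G)
    (v : 'I_k -> 'rV[R]_m) :
  left_invariant_form w (g * x)%g (fun i => dL g x (v i)) =
  left_invariant_form w x v.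
Proof.
congr w; apply/funext => i.
by rewrite -[LHS]/((_ \o dL g x) (v i)) tangent_mulg invgM mulgVK.
Qed.

End LeftTranslations.

(** * Forms on the homogeneous space and their pullbacks to the group *)

Section HomogeneousForms.
Context {R : realType} {m d : nat} {G : lieGroupType R m}.
Context {H : groupClosed G} (S : smooth_structure R d (homogeneous_space H)).
Hypothesis S_homogeneous : homogeneous_structure S.

Local Notation lie := (lie_structure : smooth_structure R m G).
Local Notation q := (coset_proj H).
Local Notation dL g := (tangent_map lie lie (fun y : G => (g * y)%g)).

Lemma coset_proj_mdifferentiable (x : G) : mdifferentiable lie S q x.
Proof. by case: S_homogeneous => qS _; apply: smooth_on_mdifferentiable qS _. Qed.

Lemma local_section (x : homogeneous_space H) :
  exists2 s : homogeneous_space H -> G, mdifferentiable S lie s x &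
    \forall y \near x, q (s y) = y.
Proof.
have [_ /(_ x) [U [Ux [s sS sK]]]] := S_homogeneous.
exists s; first exact: smooth_on_mdifferentiable sS Ux.
have [oU _ _] := sS.
exact: filterS (open_nbhs_nbhs (conj oU Ux)).
Qed.

(** Differentiating [q \o s = id] for a local section [s] gives a right inverse to the differential
    of [q] at [s x]. Only this one point of the fibre is obtained. *)
Lemma tangent_coset_proj_surj (x : homogeneous_space H) :
  exists2 y : G, q y = x & forall v, exists w, tangent_map lie S q y w = v.
Proof.
have [s sd sK] := local_section x.
have qsx := nbhs_singleton sK.
exists (s x) => // v; exists (tangent_map S lie s x v).
have [qsd qsE] := tangent_map_comp sd (coset_proj_mdifferentiable (s x)).
have [_ idE] := near_mdifferentiable (g := id) sK qsd.
by rewrite -[LHS]/((_ \o _) v) -qsE -idE tangent_map_id.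
Qed.

(** With a local section [s], the action of [g] is near [x] the composite of [s], left translation
    by [g] and [q]. *)
Lemma coset_action_mdifferentiable (g : G) (x : homogeneous_space H) :
  mdifferentiable S S (coset_action g) x.
Proof.
have [s sd sK] := local_section x.
have [gsd _] := tangent_map_comp sd (mulg_mdifferentiable g (s x)).
have [qgsd _] := tangent_map_comp gsd
  (coset_proj_mdifferentiable (g * s x)%g).
have [] // := near_mdifferentiable (g := coset_action g) _ qgsd.
by apply: filterS sK => y /= {2}<-; rewrite coset_actionE.
Qed.

Variable nu : preform (R := R) d d (homogeneous_space H).

Local Notation qnu := (pullback lie S q nu).

(** The chain rule is applied to both sides of phi_g \o q = q \o L_g. *)
Lemma pullback_coset_action (g x : G) (v : 'I_d -> 'rV[R]_m) :
  qnu (g * x)%g (fun i => dL g x (v i)) =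
  pullback S S (coset_action g) nu (q x) (fun i => tangent_map lie S q x (v i)).
Proof.
have [_ E1] := tangent_map_comp
  (mulg_mdifferentiable g x) (coset_proj_mdifferentiable (g * x)%g).
have [_ E2] := tangent_map_comp
  (coset_proj_mdifferentiable x) (coset_action_mdifferentiable g (q x)).
rewrite /pullback coset_actionE; congr (nu _); apply/funext => i.
rewrite -[LHS]/((_ \o _) (v i)) -[RHS]/((_ \o _) (v i)) -E1 -E2.
suff -> : q \o (fun y : G => (g * y)%g) = coset_action g \o q by [].
by apply/funext => y /=; rewrite coset_actionE.
Qed.

Variable sigma : G -> R.
Hypothesis sigma_nu : associated_function S nu sigma.

Lemma associated_functionM (g x : G) (v : 'I_d -> 'rV[R]_m) :
  qnu (g * x)%g (fun i => dL g x (v i)) =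
  expR (sigma (g * x)%g - sigma x) * qnu x v.
Proof.
have [_ _ E] := sigma_nu.
by rewrite !E left_invariant_formM mulrA -expRD subrK.
Qed.

Hypothesis nu_volume : is_volume_form S nu.

(** Surjectivity of the differential of [q] at a single point [y] suffices: left translation by
    [x * y^-1] carries nonvanishing from [y] to [x], as it only multiplies by an exponential. *)
Lemma pullback_coset_proj_neq0 (x : G) : exists v, qnu x v != 0.
Proof.
have [y _ dq] := tangent_coset_proj_surj (q 1%g).
have [v nu_v] := nu_volume.2 (q y).
pose w i := sval (cid (dq (v i))).
have qnu_w : qnu y w = nu (q y) v.
  by congr (nu _); apply/funext => i; exact: (svalP (cid (dq (v i)))).
exists (fun i => dL (x * y^-1)%g y (w i)).
rewrite -{1}(mulgVK y x) associated_functionM qnu_w.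
by rewrite mulf_neq0 // gt_eqF // expR_gt0.
Qed.

Lemma semi_invariant_multiplicative :
  semi_invariant S nu -> multiplicative_function sigma.
Proof.
move=> [c [_ _ cE]].
(* Both factors multiply the same nonzero value of [qnu] at [x]. The left-hand side is independent
   of [x], so [x = h] and [x = 1] can be compared below. *)
have cM g x : c g = expR (sigma (g * x)%g - sigma x).
  have [v v0] := pullback_coset_proj_neq0 x.
  apply: (mulIf v0).
  by rewrite -associated_functionM pullback_coset_action cE.
have [_ s1 _] := sigma_nu.
move=> g h; apply/(canRL (subrK _))/expR_inj.
by rewrite -cM (cM g 1%g) mulg1 s1 subr0.
Qed.

Lemma multiplicative_semi_invariant :
  multiplicative_function sigma -> semi_invariant S nu.
Proof.
move=> sM; exists (expR \o sigma); split=> [a Sa k|g|g x v].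
- have [sS _ _] := sigma_nu.
  by apply: Ck_expR (sS a Sa k); exact: chart_cod_open.
- exact: expR_gt0.
(* The identity is checked upstairs, at a point [y] over [x] where every tangent vector [v i] lifts
   to some [w i]. *)
have [y <- dq] := tangent_coset_proj_surj x.
pose w i := sval (cid (dq (v i))).
have <- : (fun i => tangent_map lie S q y (w i)) = v.
  by apply/funext => i; exact: (svalP (cid (dq (v i)))).
by rewrite -pullback_coset_action associated_functionM sM addrK.
Qed.

End HomogeneousForms.

Theorem theorem2p5 (R : realType) (m n : nat) (G : lieGroupType R m)
    (G_connected : connected [set: G])
    (H : groupClosed G) (H_lie : closed_connected_lie_subgroup H n)
    (S : smooth_structure R (m - n) (homogeneous_space H))
    (S_homogeneous : homogeneous_structure S)
    (nu : preform (m - n) (m - n) (homogeneous_space H))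
    (nu_volume : is_volume_form S nu)
    (sigma : G -> R) (sigma_nu : associated_function S nu sigma) :
  semi_invariant S nu <-> multiplicative_function sigma.
Proof.
split.
  exact: (semi_invariant_multiplicative S_homogeneous sigma_nu nu_volume).
exact: (multiplicative_semi_invariant S_homogeneous sigma_nu).
Qed.
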